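(* Let $s\in\{\tfrac12,1,\tfrac32,\dots\}$. For any density operator $\rho$ in the spin-$s$ representation there is a (classical) probability measure $\mu$ on the sphere $\{x\in\mathbb R^3: |x|=\sqrt{s(s+1)}\}$ which has the same first and second moments as the angular momentum in $\rho$, i.e., for all $j,k\in\{1,2,3\}$, $$\int\mu(dx)\,x_j=\operatorname{tr}(\rho L_j)\qquad\text{and}\qquad \int\mu(dx)\,x_jx_k=\operatorname{Re}\operatorname{tr}(\rho L_jL_k).$$
   Context: The spin-$s$ representation is the irreducible $(2s+1)$-dimensional representation of $SU(2)$ on $\mathbb C^{2s+1}$, with angular momentum operators $L_1,L_2,L_3$ ($\hbar=1$, $[L_1,L_2]=iL_3$ and cyclic, $L_1^2+L_2^2+L_3^2=s(s+1)\mathbb 1$). A density operator is a positive semidefinite operator of trace 1. *)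

(* Defs.v *)
(* MathComp + MathComp-Analysis; C is modelled as R[i] over R : realType. *)
From mathcomp Require Import all_boot all_order all_algebra.
From mathcomp Require Import complex.
From mathcomp Require Import all_classical all_reals all_analysis.

Set Implicit Arguments.
Unset Strict Implicit.
Unset Printing Implicit Defensive.

Import Order.TTheory GRing.Theory Num.Theory.
Import numFieldNormedType.Exports.

Local Open Scope classical_set_scope.
Local Open Scope ring_scope.
Local Open Scope complex_scope.
Local Open Scope sesquilinear_scope.

Definition commutator (R : realType) n (A B : 'M[R[i]]_n) : 'M[R[i]]_n :=
  A *m B - B *m A.

(* No proper nonzero subspace of C^n is invariant under every L j.  Operators
   act on column vectors whereas MathComp encodes a subspace as the row space of
   a matrix V, hence the transpose. *)
Definition irreducible_family (R : realType) n (L : 'I_3 -> 'M[R[i]]_n) :=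
  forall V : 'M[R[i]]_n, (forall j, stablemx V (L j)^T) ->
    V = 0 \/ row_full V.

(* The angular momentum operators L_1, L_2, L_3 (indexed here by 0, 1, 2) of the
   irreducible representation of SU(2) of spin s = N/2, on C^(2s+1) = C^(N+1).
   The representation enters through its Hermitian generators, and is fixed by
   them since SU(2) is simply connected.  Index arithmetic in 'I_3 is modulo 3,
   so the second field is [L_1, L_2] = i L_3 and its cyclic permutations. *)
Record spin_representation (R : realType) (s : R) (N : nat)
    (L : 'I_3 -> 'M[R[i]]_N.+1) : Prop := SpinRepresentation {
  spin_hermitian : forall j, L j \is hermsymmx;
  spin_commutator : forall j : 'I_3,
    commutator (L j) (L (j + 1)) = 'i *: L (j + 2);
  spin_casimir : \sum_j L j *m L j = (s * (s + 1))%:C%:M;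
  spin_irreducible : irreducible_family L
}.

(* The order on R[i] makes 0 <= z mean that z is real and nonnegative. *)
Definition possemidefmx (R : realType) n (A : 'M[R[i]]_n) : Prop :=
  A \is hermsymmx /\ forall v : 'cV[R[i]]_n, 0 <= (v ^t* *m A *m v) 0 0.

Definition density_operator (R : realType) n (rho : 'M[R[i]]_n) : Prop :=
  possemidefmx rho /\ \tr rho = 1.

(* R^3 with its Borel sigma-algebra. *)
Notation borelR3 R := (g_sigma_algebraType (@open 'rV[R]_3)).

(* The norm of 'rV[R]_3 in the library is the sup norm, so the Euclidean one
   is written out. *)
Definition euclidean_sphere (R : realType) (r : R) : set (borelR3 R) :=
  [set x : 'rV[R]_3 | Num.sqrt (\sum_j x 0 j ^+ 2) = r].

(* Main.v *)
(* The real moment matrix X_jk = Re tr(rho T_j T_k) of T = (1, L_1, L_2, L_3)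
   is a sum of rank-one matrices p^T p: writing rho = B^* B, take for p the real
   and imaginary parts of the entries of the B T_j.  The Casimir relation says
   that the Lorentz form q(t, y) = |y|^2 - s(s+1) t^2 sums to zero over these p.
   As in the rank-one decomposition of Sturm and Zhang, rotating a pair of
   vectors on which q has opposite signs makes q vanish on one of them without
   changing X; iterating, all the p = (t, y) become null vectors of q, and the
   measure is the sum of the point masses t^2 at y / t. *)
From HB Require Import structures.
Require Import Defs.
From mathcomp Require Import all_boot all_order all_algebra.
From mathcomp Require Import complex ring lra.
From mathcomp Require Import all_classical all_reals all_analysis.

Set Implicit Arguments.
Unset Strict Implicit.
Unset Printing Implicit Defensive.

Import Order.TTheory GRing.Theory Num.Theory.
Import measurable_realfun numFieldNormedType.Exports.
Local Open Scope classical_set_scope.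
Local Open Scope ring_scope.
Local Open Scope complex_scope.
Local Open Scope sesquilinear_scope.

(** * Rank-one decompositions into isotropic vectors *)

Definition quadform (F : fieldType) n (A : 'M[F]_n) (p : 'rV[F]_n) : F :=
  (p *m A *m p^T) 0 0.

(** By linearity of the trace, the sum of a quadratic form over a list depends only on the sum of
    the [p^T *m p]. *)
Lemma quadformE (F : fieldType) n (A : 'M[F]_n) (p : 'rV[F]_n) :
  quadform A p = \tr (A *m (p^T *m p)).
Proof. by rewrite mulmxA mxtrace_mulC mulmxA /mxtrace big_ord1. Qed.

(** Opposite signs make the discriminant of the quadratic q(p + t p') in t positive, so it has a
    real root; rotating the pair (p, p') preserves the sum of the two rank-one matrices. *)
Lemma isotropic_rotation (F : rcfType) n (A : 'M[F]_n) (p p' : 'rV[F]_n) :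
  quadform A p * quadform A p' < 0 ->
  exists u w : 'rV[F]_n, quadform A u = 0 /\
    u^T *m u + w^T *m w = p^T *m p + p'^T *m p'.
Proof.
set a := quadform A p; set a' := quadform A p'; move=> aa'.
(* Both cross terms are kept because [A] need not be symmetric. *)
pose b := (p *m A *m p'^T) 0 0 + (p' *m A *m p^T) 0 0.
pose t := (- b + Num.sqrt (b ^+ 2 - 4 * (a * a'))) / (2 * a').
have a'0 : a' != 0 by apply: contraTneq aa' => ->; rewrite mulr0 ltxx.
have troot : a + t * b + t ^+ 2 * a' = 0.
  have D0 : 0 <= b ^+ 2 - 4 * (a * a') by have := sqr_ge0 b; nra.
  have := sqr_sqrtr D0; rewrite /t; set r := Num.sqrt _ => rE.
  have -> : a + (- b + r) / (2 * a') * b + ((- b + r) / (2 * a')) ^+ 2 * a'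
          = (r ^+ 2 - (b ^+ 2 - 4 * (a * a'))) / (4 * a') by field.
  by rewrite rE subrr mul0r.
have T0 : 0 < 1 + t ^+ 2 by have := sqr_ge0 t; lra.
(* [k] is the cosine of the angle whose tangent is [t]. *)
pose k := (Num.sqrt (1 + t ^+ 2))^-1.
have kE : k ^+ 2 * (1 + t ^+ 2) = 1.
  by rewrite exprVn sqr_sqrtr ?ltW// mulVf// gt_eqF.
(* The rotation by the angle of tangent t, a root of q (p + t p'). *)
exists (k *: (p + t *: p')), (k *: (p' - t *: p)); split.
  transitivity (k ^+ 2 * (a + t * b + t ^+ 2 * a')); last first.
    by rewrite troot mulr0.
  have trE : (k *: (p + t *: p'))^T = k *: (p^T + t *: p'^T).
    by rewrite linearZ /= linearD /= linearZ.
  rewrite /quadform trE.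
  rewrite -!scalemxAl -!scalemxAr !mulmxDl !mulmxDr -?scalemxAl -?scalemxAr -?scalemxAl.
  by rewrite /a /a' /b /quadform !mxE; ring.
apply/matrixP => i j; rewrite !mxE !big_ord1 !mxE.
by rewrite -[RHS]mul1r -kE; ring.
Qed.

Lemma isotropic_decomposition (F : rcfType) n (A : 'M[F]_n) (ps : seq 'rV[F]_n) :
  \sum_(p <- ps) quadform A p = 0 ->
  exists2 qs : seq 'rV[F]_n, forall q, q \in qs -> quadform A q = 0 &
    \sum_(q <- qs) q^T *m q = \sum_(p <- ps) p^T *m p.
Proof.
have [m] := ubnP (size ps); elim: m ps => // m IH [|p ps]/= szps sum0.
  by exists [::].
(* The induction step: emit one isotropic [u] and recurse on a list [rs] of the length of [ps]. The
   form still sums to zero over [rs], since the total matrix is unchanged. *)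
have consE (u : 'rV[F]_n) (rs : seq 'rV[F]_n) :
    quadform A u = 0 -> size rs = size ps ->
    u^T *m u + \sum_(q <- rs) q^T *m q = \sum_(q <- p :: ps) q^T *m q ->
  exists2 qs : seq 'rV[F]_n, forall q, q \in qs -> quadform A q = 0 &
    \sum_(q <- qs) q^T *m q = \sum_(q <- p :: ps) q^T *m q.
  move=> u0 szrs rsE.
  have [||qs qs0 qsE] := IH rs; first by rewrite szrs.
    have : \sum_(q <- u :: rs) quadform A q = \sum_(q <- p :: ps) quadform A q.
      under eq_bigr do rewrite quadformE.
      under [RHS]eq_bigr do rewrite quadformE.
      by rewrite -!(raddf_sum (mxtrace \o mulmx A)) -rsE big_cons.
    by rewrite sum0 big_cons u0 add0r.
  exists (u :: qs); last by rewrite big_cons qsE.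
  by move=> q; rewrite inE => /predU1P[->//|/qs0].
have [p0|p0] := eqVneq (quadform A p) 0.
  by apply: (consE p ps) => //; rewrite big_cons.
(* Otherwise q(p) times the zero sum would be at least q(p)^2 > 0. *)
have [p' p'ps opp] : exists2 p', p' \in ps & quadform A p * quadform A p' < 0.
  apply/hasP; apply/negPn/negP => /hasPn nopp.
  have : quadform A p * \sum_(q <- p :: ps) quadform A q = 0.
    by rewrite sum0 mulr0.
  apply/eqP; rewrite gt_eqF// big_cons mulrDr ltr_pwDl//.
    by rewrite -expr2 exprn_even_gt0.
  rewrite mulr_sumr big_seq sumr_ge0// => q /nopp.
  by rewrite -leNgt.
have [u [w [u0 uwE]]] := isotropic_rotation opp.
(* [u] is emitted in place of [p], and [w] replaces [p'] in the tail. *)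
apply: (consE u (w :: rem p' ps)) => //=.
  by rewrite size_rem// prednK//; case: (ps) p'ps.
by rewrite !big_cons addrA uwE (perm_big _ (perm_to_rem p'ps)) big_cons addrA.
Qed.

(** * Positive semidefinite operators and their moment matrices *)

Lemma possemidef_factor (R : realType) n (A : 'M[R[i]]_n) :
  possemidefmx A -> exists B : 'M[R[i]]_n, A = B^t* *m B.
Proof.
move=> [Aherm Age0].
have /hermitian_normalmx/orthomx_spectralP := Aherm.
set P := spectralmx A; set d := spectral_diag A => AE.
have PU : P \is unitarymx := spectral_unitarymx A.
move: AE; rewrite invmx_unitary// => AE.
have PPt : P *m P^t* = 1%:M by apply/unitarymxP.
(* The eigenvalue [d 0 i] is the value of the Hermitian form of [A] at its eigenvector, column [i]
   of [P^t*]. *)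
have d_ge0 i : 0 <= d 0 i.
  have := Age0 (P^t* *m delta_mx i 0).
  rewrite AE trmx_mul map_mxM trmxCK !mulmxA -(mulmxA _ P) PPt mulmx1.
  rewrite -!mulmxA (mulmxA P) PPt mul1mx mulmxA.
  by rewrite trmx_delta map_delta_mx -rowE -colE !mxE eqxx mulr1n.
exists (diag_mx (map_mx sqrtC d) *m P).
rewrite trmx_mul map_mxM tr_diag_mx map_diag_mx mulmxA -(mulmxA _ (diag_mx _)).
rewrite mulmx_diag {1}AE; congr (_ *m diag_mx _ *m _).
apply/rowP => i; rewrite !mxE.
have s_ge0 : 0 <= sqrtC (d 0 i) by rewrite sqrtC_ge0.
by rewrite [X in X * _](geC0_conj s_ge0) -expr2 sqrtCK.
Qed.

Lemma hermitian_moments (R : realType) n m (rho : 'M[R[i]]_n)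
    (T : 'I_m -> 'M[R[i]]_n) :
  possemidefmx rho -> (forall j, T j \is hermsymmx) ->
  exists ps : seq 'rV[R]_m, forall j k,
    \sum_(p <- ps) p 0 j * p 0 k = complex.Re (\tr (rho *m T j *m T k)).
Proof.
move=> /possemidef_factor[B ->] Therm.
pose v (f : R[i] -> R) (ab : 'I_n * 'I_n) : 'rV[R]_m :=
  \row_j f ((B *m T j) ab.1 ab.2).
exists (map (v (@complex.Re R)) (index_enum _)
  ++ map (v (@complex.Im R)) (index_enum _)) => j k.
rewrite big_cat/= !big_map -big_split/=.
have Tk : T k = (T k)^t*.
  by have /is_hermitianmxP := Therm k; rewrite expr0 scale1r.
have BTk : (T k)^t* *m B^t* = (B *m T k)^t* by rewrite trmx_mul map_mxM.
(* By cyclicity the trace is tr((B T_k)^* B T_j), the Hermitian inner product of the entries of B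
   T_j and B T_k; its real part is the Euclidean product of their real and imaginary parts. *)
rewrite {1}Tk mxtrace_mulC -!mulmxA (mulmxA (T k ^t*)) BTk.
pose F (a b : 'I_n) := complex.Re ((B *m T j) a b) * complex.Re ((B *m T k) a b)
  + complex.Im ((B *m T j) a b) * complex.Im ((B *m T k) a b).
rewrite (eq_bigr (fun p => F p.1 p.2)); last by move=> p _; rewrite /F !mxE.
rewrite -(pair_bigA _ F)/= exchange_big /mxtrace raddf_sum/=.
apply: eq_bigr => b _; rewrite mxE raddf_sum; apply: eq_bigr => a _.
rewrite /F [in RHS]mxE [(_^T)%R _ _]mxE.
by case: ((B *m T j) a b) ((B *m T k) a b) => [z1 z2] [w1 w2] /=; ring.
Qed.

(** * Finitely supported measures and Borel measurability *)

(** Only points of nonzero weight must lie in [D], so that default points of weight 0 may fall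
    outside the sphere. *)
Lemma finite_probability d (T : measurableType d) (R : realType) (n : nat)
    (w : nat -> {nonneg R}) (x : nat -> T) :
  \sum_(k < n) (w k)%:num = 1 ->
  exists mu : probability T R,
    (forall D, (forall k : 'I_n, (w k)%:num != 0 -> D (x k)) -> mu D = 1%E) /\
    (forall D (f : T -> R), measurable D -> measurable_fun D f ->
      (forall k : 'I_n, (w k)%:num != 0 -> D (x k)) ->
      \int[mu]_(y in D) f y = \sum_(k < n) (w k)%:num * f (x k)).
Proof.
move=> sumw; pose m := msum (fun k => mscale (w k) (dirac (x k))) n.
have mE D : (forall k : 'I_n, (w k)%:num != 0 -> D (x k)) -> m D = 1%E.
  move=> Dx; rewrite /m /msum/= -[1%E]/(1%:E) -sumw -sumEFin.
  apply: eq_bigr => k _.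
  have [wk0|/Dx Dxk] := eqVneq (w k)%:num 0; rewrite /mscale/= ?wk0 ?mul0e//.
  by rewrite diracE mem_set// mule1.
have mT : m setT = 1%E by exact: mE.
pose mu : probability T R := HB.pack m (Measure_isProbability.Build _ _ _ m mT).
exists mu; split=> // D f mD mf Dx.
have ge0 (g : T -> \bar R) : measurable_fun D g -> (forall y, D y -> 0 <= g y)%E ->
    (\int[mu]_(y in D) g y = \sum_(k < n) (w k)%:num%:E * g (x k))%E.
  move=> mg g0; rewrite ge0_integral_measure_sum//; apply: eq_bigr => k _.
  rewrite ge0_integral_mscale// integral_dirac//.
  have [->|/Dx Dxk] := eqVneq (w k)%:num 0; first by rewrite !mul0e.
  by rewrite diracE mem_set// mul1e.
have mEf : measurable_fun D (EFin \o f) by exact/measurable_EFinP.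
(* The nonnegative case is applied to the positive and negative parts of [f]. *)
rewrite /Rintegral integralE !ge0//.
- under eq_bigr do rewrite funeposE -EFin_max -EFinM.
  under [X in (_ - X)%E]eq_bigr do rewrite funenegE -EFinN -EFin_max -EFinM.
  rewrite !sumEFin/= -sumrB; apply: eq_bigr => k _.
  by rewrite -mulrBr -[in RHS](funrposBneg f).
- exact: measurable_funeneg.
- exact: measurable_funepos.
Qed.

(** Open intervals generate the Borel sets of the line, and their preimages are open. *)
Lemma borelR3_continuous_measurable (R : realType) (f : 'rV[R]_3 -> R) :
  continuous f -> measurable_fun (setT : set (borelR3 R)) (f : borelR3 R -> R).
Proof.
move=> /continuousP cf; apply: (measurability _ (RGenOpens.measurableE R)).
move=> _ [_ [a [b ->] <-]]; rewrite setTI.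
by apply: sub_sigma_algebra; apply: cf; exact: interval_open.
Qed.

Lemma measurable_euclidean_sphere (R : realType) (r : R) :
  measurable (euclidean_sphere r).
Proof.
pose g (x : 'rV[R]_3) := Num.sqrt (\sum_j x 0 j ^+ 2).
have cg : continuous g.
  move=> x; apply: (@continuous_comp _ _ _ (fun x : 'rV[R]_3 => \sum_j x 0 j ^+ 2) Num.sqrt).
    apply: continuous_big => [|j _ y]; first exact: add_continuous.
    apply: (@continuous_comp _ _ _ (fun x : 'rV[R]_3 => x 0 j) (fun z : R => z ^+ 2)).
      exact: coord_continuous.
    exact: exprn_continuous.
  exact: sqrt_continuous.
have := borelR3_continuous_measurable cg measurableT (measurable_set1 r).
by rewrite setTI.
Qed.

(** * The Lorentz form and the measure on the sphere *)

Definition lorentzmx (R : realType) (c : R) : 'M[R]_4 :=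
  diag_mx (\row_i if i == 0 then - c else 1).

Lemma quadform_lorentz (R : realType) (c : R) (p : 'rV[R]_4) :
  quadform (lorentzmx c) p
    = \sum_j p 0 (lift 0 j) ^+ 2 - c * (p 0 0 * p 0 0).
Proof.
rewrite /quadform mul_mx_diag mxE big_ord_recl !mxE/= addrC; congr (_ + _).
  by apply: eq_bigr => j _; rewrite !mxE/= mulr1 expr2.
by rewrite mulrN mulNr mulrAC mulrC.
Qed.

(** If t is nonzero, nullity of (t, y) puts y / t on the sphere, and the mass t^2 there contributes
    t y_j and y_j y_k to the moments. If t = 0, nullity forces y = 0, so nothing is lost. *)
Lemma lorentz_isotropic_probability (R : realType) (c : R) (qs : seq 'rV[R]_4) :
  (forall q, q \in qs -> quadform (lorentzmx c) q = 0) ->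
  \sum_(q <- qs) q 0 0 * q 0 0 = 1 ->
  exists mu : probability (borelR3 R) R,
    let S := euclidean_sphere (Num.sqrt c) in
    [/\ mu S = 1%E,
        forall j : 'I_3, \int[mu]_(x in S) (x : 'rV[R]_3) 0 j
          = \sum_(q <- qs) q 0 0 * q 0 (lift 0 j)
      & forall j k : 'I_3,
          \int[mu]_(x in S) ((x : 'rV[R]_3) 0 j * (x : 'rV[R]_3) 0 k)
          = \sum_(q <- qs) q 0 (lift 0 j) * q 0 (lift 0 k)].
Proof.
move=> qs0 sum1.
have null q : q \in qs -> \sum_j q 0 (lift 0 j) ^+ 2 = c * q 0 0 ^+ 2.
  by move=> /qs0; rewrite quadform_lorentz => /subr0_eq ->; rewrite expr2.
pose q_ k := nth 0 qs k.
pose w k : {nonneg R} := NngNum (sqr_ge0 (q_ k 0 0)).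
(* For t = 0 the junk point 0 gets weight 0. *)
pose x k : borelR3 R := \row_j (q_ k 0 (lift 0 j) / q_ k 0 0).
have sumE (F : 'rV[R]_4 -> R) : \sum_(k < size qs) F (q_ k) = \sum_(q <- qs) F q.
  by rewrite (big_nth 0) big_mkord.
have [|mu [muS muI]] := @finite_probability _ (borelR3 R) R (size qs) w x.
  by rewrite -sum1 -sumE; apply: eq_bigr => k _; rewrite /= expr2.
have xS (k : 'I_(size qs)) : (w k)%:num != 0 ->
    euclidean_sphere (Num.sqrt c) (x k).
  rewrite /= sqrf_eq0 => t0; congr Num.sqrt.
  under eq_bigr do rewrite mxE expr_div_n.
  by rewrite -mulr_suml null ?mem_nth// mulfK// sqrf_eq0.
have mS := measurable_euclidean_sphere (Num.sqrt c).
have mcoord (j : 'I_3) :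
    measurable_fun (setT : set (borelR3 R)) (fun y : borelR3 R => (y : 'rV[R]_3) 0 j).
  by apply: borelR3_continuous_measurable; exact: coord_continuous.
exists mu; split=> [|j|j k]; first exact: muS.
- rewrite muI//; last exact: measurable_funTS.
  rewrite -sumE; apply: eq_bigr => k _; rewrite mxE /=.
  have [->|t0] := eqVneq (q_ k 0 0) 0; first by rewrite expr0n !mul0r.
  by field.
- rewrite muI//; last by apply: measurable_funTS; exact: measurable_funM.
  rewrite -sumE; apply: eq_bigr => l _; rewrite !mxE /=.
  have [t0|t0] := eqVneq (q_ l 0 0) 0; last by field.
  rewrite t0 expr0n mul0r.
  (* Here the squares of the y_j sum to zero, so each y_j vanishes. *)
  have /eqP := null _ (mem_nth 0 (ltn_ord l)).
  rewrite -/(q_ l) t0 expr0n mulr0 psumr_eq0 => [/allP/(_ j)|? _]; last exact: sqr_ge0.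
  by rewrite mem_index_enum sqrf_eq0 => /(_ isT)/eqP ->; rewrite mul0r.
Qed.

(** * From the quantum moments to the measure *)

(** Conjugation reverses the product, and cyclicity of the trace restores it. This turns the real
    parts in the first moments into the traces themselves. *)
Lemma hermitian_mulmx_trace_real (R : realType) n (A B : 'M[R[i]]_n) :
  A \is hermsymmx -> B \is hermsymmx -> \tr (A *m B) \is Num.real.
Proof.
move=> /is_hermitianmxP; rewrite expr0 scale1r => Aherm.
move=> /is_hermitianmxP; rewrite expr0 scale1r => Bherm.
apply/CrealP; rewrite -trace_map_mx -mxtrace_tr map_trmx trmx_mul map_mxM.
by rewrite -Aherm -Bherm mxtrace_mulC.
Qed.

Unset Implicit Arguments.

Theorem proposition5 (R : realType) (s : R) (N : nat)
    (N_gt0 : (0 < N)%N) (s_def : s = N%:R / 2)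
    (L : 'I_3 -> 'M[R[i]]_N.+1) (L_spin : spin_representation s L)
    (rho : 'M[R[i]]_N.+1) (rho_density : density_operator rho) :
  exists mu : probability (borelR3 R) R,
    let S := euclidean_sphere (Num.sqrt (s * (s + 1))) in
    [/\ mu S = 1%E,
        forall j : 'I_3,
          (\int[mu]_(x in S) (x : 'rV[R]_3) 0 j)%:C = \tr (rho *m L j)
      & forall j k : 'I_3,
          \int[mu]_(x in S) ((x : 'rV[R]_3) 0 j * (x : 'rV[R]_3) 0 k)
          = complex.Re (\tr (rho *m L j *m L k))].
Proof.
case: rho_density => rho_psd rho_tr; have rho_herm := rho_psd.1.
case: L_spin => Lherm _ casimir _; set c := s * (s + 1) in casimir *.
(* Placing the identity at index 0 makes the first moments the entries (0, j) of the second moment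
   matrix. *)
pose T (i : 'I_4) := oapp L 1%:M (unlift 0 i).
have T0 : T 0 = 1%:M by rewrite /T unlift_none.
have Tlift j : T (lift 0 j) = L j by rewrite /T liftK.
have Therm i : T i \is hermsymmx.
  by rewrite /T; case: unlift => [j|]; [exact: Lherm|exact: hermitian1mx_subproof].
have [ps psE] := hermitian_moments rho_psd Therm.
have [|qs qs0 qsE] := @isotropic_decomposition R 4 (lorentzmx c) ps.
  (* The t^2 sum to tr rho = 1, and the |y|^2 sum to the expectation of the Casimir operator, which
     is [c]. *)
  under eq_bigr do rewrite quadform_lorentz.
  rewrite sumrB exchange_big -mulr_sumr psE T0 !mulmx1 rho_tr/= mulr1.
  apply/eqP; rewrite subr_eq0; apply/eqP.
  have sumLL : \sum_j L j *m L j = c%:C%:M by exact: casimir.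
  transitivity (complex.Re (\tr (rho *m (\sum_j L j *m L j)))).
    rewrite mulmx_sumr (raddf_sum mxtrace) (raddf_sum (@complex.Re R)).
    apply: eq_bigr => j _.
    by rewrite /= mulmxA -Tlift -psE; apply: eq_bigr => p _; rewrite expr2.
  by rewrite sumLL mul_mx_scalar mxtraceZ rho_tr mulr1.
have momE i k : \sum_(q <- qs) q 0 i * q 0 k
    = complex.Re (\tr (rho *m T i *m T k)).
  rewrite -psE; move/matrixP/(_ i k): qsE; rewrite !summxE.
  under eq_bigr do rewrite mxE big_ord1 mxE.
  by under [RHS]eq_bigr do rewrite mxE big_ord1 mxE.
have [|mu [muS mu1 mu2]] := lorentz_isotropic_probability qs0.
  by rewrite momE T0 !mulmx1 rho_tr.
exists mu; split=> // [j|j k].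
- rewrite mu1 momE T0 mulmx1 Tlift RRe_real//.
  exact: hermitian_mulmx_trace_real.
- by rewrite mu2 momE !Tlift.
Qed.
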